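(* Let $T>0$, let $f\colon\mathbb{R}\to\mathbb{R}$ be continuous and $T$-periodic, let $\alpha\in(0,1)$, and suppose that the fractional integral $I^{1-\alpha}f$ is a bounded function. Then the Riemann-Liouville fractional derivative ${}^{RL}D^\alpha f$ is an asymptotically $T$-periodic function.
   Context: Write $\mathbb{R}^+=[0,+\infty)$. For $\beta>0$, the fractional integral of order $\beta$ is $I^\beta h(t)=\dfrac{1}{\Gamma(\beta)}\displaystyle\int_0^t (t-s)^{\beta-1}h(s)\,ds$, $t>0$. For $\alpha\in(0,1)$, the Riemann-Liouville fractional derivative is ${}^{RL}D^\alpha f(t)=\dfrac{d}{dt}\left(I^{1-\alpha}f\right)(t)$, provided the right-hand side is defined for almost every $t\in\mathbb{R}^+$. $\mathcal{C}_0(\mathbb{R}^+,\mathbb{R})$ is the set of bounded continuous functions $h\colon\mathbb{R}^+\to\mathbb{R}$ with $\lim_{t\to\infty}|h(t)|=0$. A continuous function $\varphi$ on $\mathbb{R}^+$ is asymptotically $T$-periodic if there exist a continuous $T$-periodic function $f_1$ and a function $f_2\in\mathcal{C}_0(\mathbb{R}^+,\mathbb{R})$ such that $\varphi=f_1+f_2$ on $\mathbb{R}^+$.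
   Formalization: The Riemann-Liouville derivative is assumed to exist almost everywhere and to agree almost everywhere with a function continuous on [0,∞); without this the claim fails, e.g. for f(t)=cos(2πt/T), whose derivative blows up like t^{-α} at 0. *)

(* Defs.v *)
From mathcomp Require Import all_boot all_order all_algebra.
From mathcomp Require Import all_classical all_reals all_analysis.
Import Order.TTheory GRing.Theory Num.Theory.
Import numFieldNormedType.Exports.

Set Implicit Arguments.
Unset Strict Implicit.
Unset Printing Implicit Defensive.

Local Open Scope classical_set_scope.
Local Open Scope ring_scope.

Definition Gamma {R : realType} (b : R) : R :=
  \int[lebesgue_measure]_(x in `[0, +oo[) (x `^ (b - 1) * expR (- x)).

Definition fractional_integral {R : realType} (b : R) (h : R -> R) (t : R) : R :=
  (Gamma b)^-1 *
  \int[lebesgue_measure]_(s in `[0, t]) ((t - s) `^ (b - 1) * h s).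

(* The derivative D^alpha f = d/dt (I^(1-alpha) f) is a partial function, which
   need only be defined almost everywhere on R^+.  The predicate says that it is
   so defined and that it is the function phi; as a function defined almost
   everywhere, it is identified up to a null set.  The values of phi on ]-oo, 0[
   play no role. *)
Definition is_RL_derivative {R : realType} (alpha : R) (f phi : R -> R) : Prop :=
  {ae lebesgue_measure, forall t : R, 0 < t ->
    is_derive t 1 (fractional_integral (1 - alpha) f) (phi t)}.

Definition C0 {R : realType} (h : R -> R) : Prop :=
  [/\ {within `[0, +oo[, continuous h},
      [bounded h t | t in `[0, +oo[] &
      `|h t| @[t --> +oo] --> 0].

(* The periodic part f1 is taken on the whole line; a continuous T-periodic
   function on R^+ extends uniquely to such a function. *)
Definition asymptotically_periodic {R : realType} (T : R) (phi : R -> R) : Prop :=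
  {within `[0, +oo[, continuous phi} /\
  exists f1 f2 : R -> R,
    [/\ continuous f1, periodic f1 T, C0 f2 &
        forall t, 0 <= t -> phi t = f1 t + f2 t].

(* Main.v *)
Require Import Defs.
From mathcomp Require Import all_boot all_order all_algebra.
From mathcomp Require Import all_classical all_reals all_analysis.
From mathcomp Require Import measurable_realfun ring lra.
Import Order.TTheory GRing.Theory Num.Theory.
Import numFieldNormedType.Exports.

Local Open Scope classical_set_scope.
Local Open Scope ring_scope.

(** Write F for the fractional integral of order 1 - alpha of f. The idea is
    to compare F with its translate by one period. Since f is periodic, the
    part of F (t + T) coming from the integration range [T, t + T] is exactly
    F t, so that
      G t := F (t + T) - F t = c * \int_0^T (t + T - s)^(- alpha) f(s) ds
    (fractional_integral_period_increment). For t > 0 the singularity of the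
    kernel lies outside the range of this last integral, and G is as regular
    as the kernel away from 0.

    The kernel is convex and decreasing, so its decrement on [x, x + h] with
    x >= t is at most h / T times its decrement on [t - T, t]. Integrating,
      |G (t + h) - G t| <= (psi t - psi (t + T)) * h,
    where psi t := K (t - T)^(- alpha) and t > T
    (fractional_integral_period_increment_lipschitz). At almost every t the
    function G has derivative phi (t + T) - phi t, which is therefore bounded
    by psi t - psi (t + T); by continuity of phi the bound holds at every
    t > T. The estimates are on difference quotients of F because F need not
    be the integral of its almost everywhere derivative.

    The bound telescopes: |phi (t + nT) - phi t| <= psi t for every n, and psi
    tends to 0 at infinity. Hence phi (t + nT) converges as n grows, uniformly
    enough for the limit to be continuous; the limit is the periodic part, and
    phi differs from it by at most psi
    (asymptotically_periodic_increment). *)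

(** * The power kernel *)

Lemma within_continuous_powR {R : realType} (p a b : R) :
  0 < a -> {within `[a, b], continuous (fun x : R => x `^ p)}.
Proof.
move=> a0; apply: derivable_within_continuous => x.
rewrite in_itv/= => /andP[ax _].
by apply: derivable_powR; rewrite in_itv/= andbT (lt_le_trans a0).
Qed.

(** This is convexity of the kernel in the form of the mean value theorem: both
    decrements are slopes at intermediate points, and the derivative of the
    kernel is smaller in absolute value on [x, x + h] than on [a, a + T]. The
    bound by a decrement, rather than by a derivative, is what makes the final
    estimate telescope. *)
Lemma powRN_secant_le {R : realType} (p a x T h : R) :
  0 < p -> 0 < a -> 0 < T -> 0 < h -> a + T <= x ->
  x `^ (- p) - (x + h) `^ (- p) <= h / T * (a `^ (- p) - (a + T) `^ (- p)).
Proof.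
move=> p0 a0 T0 h0 aTx.
have dp (u v : R) : 0 < u -> forall z : R, z \in `]u, v[ ->
    is_derive z 1 (fun y : R => y `^ (- p)) (- p * z `^ (- p - 1)).
  move=> u0 z; rewrite in_itv/= => /andP[uz _].
  exact/is_derive1_powR/(lt_trans u0).
have x0 : 0 < x by rewrite (lt_le_trans _ aTx)// addr_gt0.
have [||xi] := MVT _ (dp a (a + T) a0).
  by rewrite ltrDl.
  exact: within_continuous_powR.
rewrite in_itv/= => /andP[axi xiaT] Exi.
have [||eta] := MVT _ (dp x (x + h) x0).
  by rewrite ltrDl.
  exact: within_continuous_powR.
rewrite in_itv/= => /andP[xeta _] Eeta.
have -> : x `^ (- p) - (x + h) `^ (- p) = h * p * eta `^ (- p - 1).
  by rewrite -[LHS]opprB Eeta; ring.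
have -> : a `^ (- p) - (a + T) `^ (- p) = T * (p * xi `^ (- p - 1)).
  by rewrite -[LHS]opprB Exi; ring.
rewrite mulrA mulfVK ?gt_eqF// mulrA ler_pM2l ?mulr_gt0//.
have xi0 : 0 < xi by rewrite (lt_trans a0).
have eta0 : 0 < eta by rewrite (lt_trans x0).
rewrite -opprD !powRN lef_pV2 ?posrE ?powR_gt0//.
apply: ge0_ler_powR; rewrite ?nnegrE ?ltW ?addr_gt0//.
by rewrite (lt_trans xiaT)// (le_lt_trans aTx).
Qed.

Lemma is_derive_powR_reflect {R : realType} (q t s : R) : s < t ->
  is_derive s 1 (fun u : R => (t - u) `^ q) (- (q * (t - s) `^ (q - 1))).
Proof.
move=> st.
have dq : is_derive (t - s) 1 (fun y : R => y `^ q) (q * (t - s) `^ (q - 1)).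
  by apply: is_derive1_powR; rewrite subr_gt0.
have dt : is_derive s 1 (fun u : R => t - u) (-1).
  by rewrite -[X in is_derive _ _ _ X]sub0r; apply: is_deriveB.
have := @realfun.is_derive1_comp R (fun y : R => y `^ q) (fun u : R => t - u)
  s _ _ dq dt.
by rewrite mulrN1.
Qed.

(** The kernel has the explicit primitive P below, which stays bounded up to the
    singularity at s = t; the integrals over an exhaustion of [0, t[ by
    segments are then bounded, and monotone convergence concludes. *)
Lemma integrable_powR_singularity {R : realType} (p t : R) :
  p < 1 -> 0 < t ->
  lebesgue_measure.-integrable `[0, t] (EFin \o fun s => (t - s) `^ (- p)).
Proof.
move=> p1 t0.
pose k := fun s : R => (t - s) `^ (- p).
have mk D : measurable_fun D k.
  apply: measurable_funTS.
  apply: (measurableT_comp (f := fun x : R => x `^ (- p))).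
    exact: measurable_powR.
  exact: measurable_funB.
apply/integrableP; split; first (apply/measurable_EFinP; exact: mk).
under eq_integral.
  move=> x _; rewrite /= ger0_norm ?powR_ge0//.
  over.
rewrite /= -integral_itv_bndo_bndc//; last (apply/measurable_EFinP; exact: mk).
pose A (n : nat) := `[0, t - t / n.+2%:R]%classic.
have q0 : 0 < 1 - p by rewrite subr_gt0.
have t_lt n : t - t / n.+2%:R < t by rewrite ltrBlDr ltrDl divr_gt0.
have -> : `[0, t[%classic = \bigcup_n A n.
  apply/seteqP; split=> s /=.
    rewrite in_itv/= => /andP[s0 st].
    have ts0 : 0 < t - s by rewrite subr_gt0.
    (* t / (t - s) < n + 1 gives t / (n + 2) <= t - s. *)
    exists (Num.truncn (t / (t - s))) => //=.
    rewrite /A/= in_itv/= s0/= lerBrDr -lerBrDl ler_pdivrMr// mulrC.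
    rewrite -ler_pdivrMr//.
    have := truncnS_gt (t / (t - s)).
    by move=> /ltW /le_trans; apply; rewrite ler_nat.
  by move=> [n _]; rewrite /A/= !in_itv/= => /andP[-> /le_lt_trans]; apply.
have ndA : nondecreasing_seq A.
  move=> m n mn; rewrite subsetEset => s; rewrite /A/= !in_itv/= => /andP[->/=].
  move=> /le_trans; apply; rewrite lerB// ler_pM2l// lef_pV2 ?posrE//.
  by rewrite ler_nat !ltnS.
have k0 n x : A n x -> (0%E <= (k x)%:E)%E by rewrite lee_fin powR_ge0.
have mA n : measurable_fun (A n) (EFin \o k) by apply/measurable_EFinP; exact: mk.
have : (\int[lebesgue_measure]_(x in A n) (k x)%:E)%E @[n --> \oo] -->
       (\int[lebesgue_measure]_(x in \bigcup_n A n) (k x)%:E)%E.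
  by apply: ge0_nondecreasing_set_cvg_integral => // n; exact: measurable_itv.
move=> /cvg_lim <-//.
apply: (@le_lt_trans _ _ ((t `^ (1 - p) / (1 - p))%:E)); last exact: ltry.
apply: lime_le.
  apply: ereal_nondecreasing_is_cvgn.
  by apply: ge0_nondecreasing_set_nondecreasing_integral => // n; exact: measurable_itv.
apply: nearW => n.
pose P (s : R) := - ((t - s) `^ (1 - p) / (1 - p)).
have dP s : s < t -> is_derive s 1 P (k s).
  move=> st.
  have dk := is_derive_powR_reflect (1 - p) t s st.
  have -> : k s = - (1 - p)^-1 *: - ((1 - p) * (t - s) `^ (1 - p - 1)).
    rewrite /k /GRing.scale/= mulrNN mulKf ?gt_eqF//; congr (_ `^ _); ring.
  have -> : P = - (1 - p)^-1 \*: (fun u : R => (t - u) `^ (1 - p)).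
    by apply/funext => u; rewrite /P mulrC -mulNr.
  exact: is_deriveZ.
have ck : {within `[0, t - t / n.+2%:R], continuous k}.
  apply: derivable_within_continuous => s; rewrite in_itv/= => /andP[_ st].
  by apply: ex_derive; apply: is_derive_powR_reflect; exact: le_lt_trans (t_lt n).
have cP : {within `[0, t - t / n.+2%:R], continuous P}.
  apply: derivable_within_continuous => s; rewrite in_itv/= => /andP[_ st].
  by apply: ex_derive; apply: dP; exact: le_lt_trans (t_lt n).
have b0 : 0 < t - t / n.+2%:R.
  by rewrite subr_gt0 ltr_pdivrMr// ltr_pMr// ltr1n.
rewrite /A (@continuous_FTC2 _ k P)//; last 2 first.
- move/continuous_within_itvP: cP => /(_ b0)[c1 c2 c3]; split => // s.
  rewrite in_itv/= => /andP[_ st].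
  by apply: ex_derive; apply: dP; exact: lt_trans (t_lt n).
- move=> s; rewrite in_itv/= => /andP[_ st]; rewrite derive1E.
  by apply: derive_val; apply: dP; exact: lt_trans (t_lt n).
rewrite -EFinB lee_fin /P subr0 opprK addrC lerBlDr lerDl.
by rewrite divr_ge0 ?powR_ge0 ?ltW.
Qed.

(** * Translation invariance of Lebesgue measure *)

(** Lebesgue measure is determined by its values on the intervals ]a, b], whose
    lengths are preserved by translations. *)
Lemma lebesgue_measure_translate {R : realType} (T : R) (A : set R) :
  measurable A ->
  pushforward lebesgue_measure
    ((fun x => x + T) : measurableTypeR R -> measurableTypeR R) A =
  lebesgue_measure A.
Proof.
(* Measurability of the translation makes the pushforward a measure. *)
have mT : measurable_fun [set: measurableTypeR R]
    ((fun x => x + T) : measurableTypeR R -> measurableTypeR R).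
  exact: measurable_funD.
move=> mA; apply/esym/lebesgue_measure_unique => //= _ [[a b]] _ <-.
rewrite /pushforward.
have -> : (fun x => x + T) @^-1` `]a, b] = `]a - T, b - T]%classic.
  by apply/seteqP; split => x /=; rewrite !in_itv/= ltrBlDr lerBrDr.
rewrite /= !lebesgue_measure_itv/= !lte_fin ltrD2r -!EFinB; case: ifP => // _.
by congr EFin; ring.
Qed.

Lemma Rintegral_translate {R : realType} (T a b : R) (g : R -> R) :
  measurable_fun [set: R] g ->
  lebesgue_measure.-integrable `[a, b] (EFin \o fun s => g (s + T)) ->
  \int[lebesgue_measure]_(s in `[a + T, b + T]) g s =
  \int[lebesgue_measure]_(s in `[a, b]) g (s + T).
Proof.
move=> mg ig; rewrite /Rintegral; congr fine.
pose tr : measurableTypeR R -> measurableTypeR R := fun x => x + T.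
have mT : measurable_fun [set: measurableTypeR R] tr by exact: measurable_funD.
have E : `[a, b]%classic = tr @^-1` `[a + T, b + T].
  by apply/seteqP; split => x /=; rewrite !in_itv/= !lerD2r.
transitivity (\int[pushforward lebesgue_measure tr]_(s in `[(a + T)%R, (b + T)%R])
    (g s)%:E)%E.
  apply: eq_measure_integral => A mA _; apply/esym.
  exact: lebesgue_measure_translate.
rewrite E (integral_pushforward mT)//.
  exact/measurable_EFinP.
by rewrite -E.
Qed.

Lemma ae_translate {R : realType} (T : R) (P : R -> Prop) :
  {ae lebesgue_measure, forall t : R, P t} ->
  {ae lebesgue_measure, forall t : R, P (t + T)}.
Proof.
move=> [N [mN N0 PN]].
exists ((fun x => x + T) @^-1` N); split.
- rewrite -[X in measurable X]setTI.
  suff : measurable_fun [set: R] (fun x : R => x + T) by apply.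
  exact: measurable_funD.
- by rewrite -N0; exact: lebesgue_measure_translate.
- by move=> t /= nP; apply: PN.
Qed.

(** * The increment of the fractional integral over a period *)

Lemma continuous_segment_bounded {R : realType} (f : R -> R) (a b : R) :
  continuous f -> exists2 M : R, 0 <= M & forall x, x \in `[a, b] -> `|f x| <= M.
Proof.
move=> cf.
have [M [_ HM]] : bounded_set (f @` `[a, b]).
  apply: compact_bounded; apply: continuous_compact; last exact: segment_compact.
  exact: continuous_subspaceT.
exists (`|M| + 1); first by rewrite addr_ge0.
move=> x xab; apply: (HM (`|M| + 1)); last by exists x.
by rewrite (le_lt_trans (ler_norm _))// ltrDl.
Qed.

Lemma measurable_powR_reflectM {R : realType} (f : R -> R) (q t : R)
    (D : set R) :
  continuous f -> measurable_fun D (fun s => (t - s) `^ q * f s).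
Proof.
move=> cf; apply: measurable_funTS; apply: measurable_funM; last first.
  exact: continuous_measurable_fun.
apply: (measurableT_comp (f := fun x : R => x `^ q)).
  exact: measurable_powR.
exact: measurable_funB.
Qed.

Lemma integrable_powR_singularityM {R : realType} (f : R -> R) (p t : R) :
  continuous f -> p < 1 -> 0 < t ->
  lebesgue_measure.-integrable `[0, t]
    (EFin \o fun s => (t - s) `^ (- p) * f s).
Proof.
move=> cf p1 t0; have [M M0 fM] := continuous_segment_bounded f 0 t cf.
have iM : lebesgue_measure.-integrable `[0, t]
    (fun s => M%:E * ((t - s) `^ (- p))%:E)%E.
  by apply: integrableZl => //; exact: integrable_powR_singularity.
apply: le_integrable iM => //.
  by apply/measurable_EFinP; exact: measurable_powR_reflectM.
move=> s st; rewrite /= lee_fin !normrM mulrC ler_wpM2r//.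
by rewrite (le_trans (fM s st))// ler_norm.
Qed.

(** The substitution s := s + T turns F t into the part of F (t + T) over
    [T, t + T]; only the first period remains. Splitting the integral requires
    the integrability of the kernel up to its singularity. *)
Lemma fractional_integral_period_increment {R : realType} (f : R -> R)
    (p T t : R) :
  continuous f -> periodic f T -> p < 1 -> 0 < T -> 0 < t ->
  fractional_integral (1 - p) f (t + T) - fractional_integral (1 - p) f t =
  (Gamma (1 - p))^-1 *
    \int[lebesgue_measure]_(s in `[0, T]) ((t + T - s) `^ (- p) * f s).
Proof.
move=> cf fT p1 T0 t0.
rewrite /fractional_integral (_ : 1 - p - 1 = - p); last by ring.
rewrite -mulrBr; congr (_ * _).
pose g s := (t + T - s) `^ (- p) * f s.
have gE s : g (s + T) = (t - s) `^ (- p) * f s.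
  by rewrite /g fT; congr (_ `^ _ * _); ring.
have ig : lebesgue_measure.-integrable `[0, t + T] (EFin \o g).
  by apply: integrable_powR_singularityM => //; exact: addr_gt0.
have -> : \int[lebesgue_measure]_(s in `[0, t]) ((t - s) `^ (- p) * f s) =
    \int[lebesgue_measure]_(s in `[T, t + T]) g s.
  have := Rintegral_translate T 0 t g; rewrite add0r => ->.
  - by apply: eq_Rintegral => s _; rewrite gE.
  - exact: measurable_powR_reflectM.
  - rewrite (_ : (fun s => g (s + T)) = fun s => (t - s) `^ (- p) * f s).
      exact: integrable_powR_singularityM.
    by apply/funext => s; rewrite gE.
rewrite -Rintegral_itv_obnd_cbnd; last first.
  apply: integrableS ig => //.
  by apply: subset_itvr; rewrite bnd_simp ltW.
have := @Rintegral_itvB _ _ _ _ T ig; rewrite !bnd_simp => <-; [|exact: ltW|].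
  by rewrite opprB addrC subrK.
by rewrite lerDr ltW.
Qed.

(** By fractional_integral_period_increment the kernel is only evaluated at
    points t + T - s >= t, where powRN_secant_le applies with the segment
    [t - T, t]. The constant is |1 / Gamma (1 - p)| times a bound of f on a
    period. *)
Lemma fractional_integral_period_increment_lipschitz {R : realType}
    (f : R -> R) (p T : R) :
  continuous f -> periodic f T -> 0 < p < 1 -> 0 < T ->
  let G u := fractional_integral (1 - p) f (u + T) -
             fractional_integral (1 - p) f u in
  exists2 K : R, 0 <= K & forall t h : R, T < t -> 0 < h ->
    `|G (t + h) - G t| <= K * ((t - T) `^ (- p) - t `^ (- p)) * h.
Proof.
move=> cf fT /andP[p0 p1] T0 G.
have [M M0 fM] := continuous_segment_bounded f 0 T cf.
exists (`|(Gamma (1 - p))^-1| * M); first exact: mulr_ge0.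
move=> t h Tt h0; have t0 : 0 < t by exact: lt_trans Tt.
rewrite /G !fractional_integral_period_increment ?addr_gt0//.
rewrite -mulrBr normrM -!mulrA ler_wpM2l//.
set D := (t - T) `^ (- p) - t `^ (- p).
have ik u : 0 < u -> lebesgue_measure.-integrable `[0, T]
    (EFin \o fun s => (u + T - s) `^ (- p) * f s).
  move=> u0.
  have := integrable_powR_singularityM f p (u + T) cf p1 (addr_gt0 u0 T0).
  apply: integrableS => //.
  by apply: subset_itvl; rewrite bnd_simp lerDr ltW.
rewrite -RintegralB ?ik ?addr_gt0//.
have iB : lebesgue_measure.-integrable `[0, T]
    (EFin \o fun s => (t + h + T - s) `^ (- p) * f s - (t + T - s) `^ (- p) * f s).
  by apply: (integrableB _ (ik (t + h) _) (ik t _)); rewrite ?addr_gt0.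
apply: (le_trans (le_normr_Rintegral _ iB)) => //.
apply: (@le_trans _ _ (\int[lebesgue_measure]_(s in `[0, T]) (M * (D * h / T)))).
  apply: le_Rintegral => //.
  - by move/integrable_norm: iB.
  - apply: continuous_compact_integrable; first exact: segment_compact.
    by apply: continuous_subspaceT => x; exact: cvg_cst.
  - move=> s sT; rewrite -mulrBl normrM mulrC.
    apply: ler_pM => //; first exact: fM.
    move: sT; rewrite /= in_itv/= => /andP[s0 sT].
    have x0 : 0 < t + T - s by rewrite -addrA ltr_wpDr ?subr_ge0.
    have -> : t + h + T - s = t + T - s + h by ring.
    rewrite distrC ger0_norm.
      have := @powRN_secant_le R p (t - T) (t + T - s) T h p0.
      rewrite subrK subr_gt0 -[_ * h / T]mulrA [D * _]mulrC; apply => //.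
      by rewrite -addrA lerDl subr_ge0.
    have xh0 : 0 < t + T - s + h by rewrite addr_gt0.
    rewrite subr_ge0 !powRN lef_pV2 ?posrE ?powR_gt0//.
    by apply: ge0_ler_powR; rewrite ?nnegrE ?lerDl; exact: ltW.
rewrite Rintegral_cst//= lebesgue_measure_itv/= lte_fin T0 -EFinB/= subr0.
by rewrite -mulrA divfK ?gt_eqF.
Qed.

(** * From increments to derivatives *)

(** One-sided increments suffice because the derivative is also the limit of
    the difference quotients from the right. *)
Lemma derive_le_lipschitz_right {R : realType} (G : R -> R) (t d L : R) :
  is_derive t 1 G d -> (forall h, 0 < h -> `|G (t + h) - G t| <= L * h) ->
  `|d| <= L.
Proof.
move=> dG.
have [dG1 <-] := dG; rewrite /derive => GL.
have := cvg_dnbhs_at_right dG1.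
move=> /cvg_norm /cvgr_to_le; apply; near=> h.
have h0 : 0 < h by near: h; exact: nbhs_right_gt.
rewrite normrZ gtr0_norm ?invr_gt0// mulrC ler_pdivrMr//=.
by rewrite /GRing.scale/= mulr1 [h + t]addrC; exact: GL.
Unshelve. all: by end_near. Qed.

(** If g t > 0, then g > 0 on a whole neighbourhood of t, which has positive
    measure. *)
Lemma ae_continuous_le0 {R : realType} (g : R -> R) (a t : R) :
  {ae lebesgue_measure, forall s : R, a < s -> g s <= 0} ->
  a < t -> {for t, continuous g} -> g t <= 0.
Proof.
move=> [N [mN N0 gN]] at_ cg; rewrite leNgt; apply/negP => gt0.
have : \forall s \near t, a < s /\ 0 < g s.
  near=> s; split; near: s; first exact: lt_nbhsr.
  exact: (cvgr_gt (g t) cg).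
move=> /nbhs_ballP[e /= e0 te].
have : `]t - e, t + e[ `<=` N.
  move=> s; rewrite -ball_itv => /te[as_ gs]; apply: gN => /= /(_ as_).
  by rewrite leNgt gs.
move=> /(le_measure lebesgue_measure); rewrite !inE => /(_ (measurable_itv _) mN).
rewrite /= N0 lebesgue_measure_itv/= lte_fin ltrD2l gtrN// -EFinD lee_fin.
lra.
Unshelve. all: by end_near. Qed.

(** * Functions with telescoping increments over a period *)

Lemma continuous_gt0 {R : realType} (phi : R -> R) (t : R) :
  {within `[0, +oo[, continuous phi} -> 0 < t -> {for t, continuous phi}.
Proof.
by move=> /continuous_within_itvcyP[cphi _] t0; apply: cphi; rewrite in_itv/= t0.
Qed.

(** The increment bound telescopes to |phi (t + nT) - phi t| <= psi t for every
    n. So the sequence phi (t + nT) is Cauchy, its limit f1 t is T-periodic,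
    and |f1 - phi| <= psi beyond a. *)
Lemma asymptotically_periodic_increment {R : realType} (phi psi : R -> R)
    (T a : R) :
  0 < T -> {within `[0, +oo[, continuous phi} ->
  (forall t, a < t -> `|phi (t + T) - phi t| <= psi t - psi (t + T)) ->
  (forall t, a < t -> 0 <= psi t) -> psi t @[t --> +oo] --> 0 ->
  asymptotically_periodic T phi.
Proof.
move=> T0 cphi phiT psi0 psi_cvg.
have phin n t : a < t -> `|phi (t + T *+ n) - phi t| <= psi t - psi (t + T *+ n).
  move=> at_; elim: n => [|n ih]; first by rewrite mulr0n addr0 !subrr normr0.
  rewrite mulrSr addrA (le_trans (ler_distD (phi (t + T *+ n)) _ _))//.
  have -> : psi t - psi (t + T *+ n + T) =
    (psi (t + T *+ n) - psi (t + T *+ n + T)) + (psi t - psi (t + T *+ n)) by ring.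
  by rewrite lerD// phiT// ltr_wpDr// mulrn_wge0// ltW.
have phin_le n t : a < t -> `|phi (t + T *+ n) - phi t| <= psi t.
  move=> at_; rewrite (le_trans (phin n t at_))// gerBl psi0//.
  by rewrite ltr_wpDr// mulrn_wge0// ltW.
have psi_small e : 0 < e -> exists A, [/\ a < A, 0 < A & forall t, A < t -> psi t < e].
  move=> e0.
  have : \forall t \near +oo, psi t < e by exact: (cvgr_lt 0 psi_cvg).
  move=> [A [_ HA]]; exists (`|A| + `|a| + 1); split.
  - have := ler_norm a; have := normr_ge0 A; lra.
  - have := normr_ge0 a; have := normr_ge0 A; lra.
  - move=> t tA; apply: HA; have := ler_norm A; have := normr_ge0 a; lra.
have reach A u : exists n, A < u + T *+ n.
  exists (Num.truncn (`|A - u| / T)).+1.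
  rewrite -ltrBlDl (le_lt_trans (ler_norm _))// -mulr_natl -ltr_pdivrMr//.
  exact: truncnS_gt.
pose f1 u := lim (phi (u + T *+ n) @[n --> \oo]).
(* Beyond an index N with psi < e past u + NT, all the terms are within e of
   the term of index N. *)
have f1_cvg u : phi (u + T *+ n) @[n --> \oo] --> f1 u.
  apply: cauchy_cvg; apply: cauchy_exP => e e0.
  have [A [aA A0 psiA]] := psi_small _ e0.
  have [N AN] := reach A u.
  exists (phi (u + T *+ N)).
  exists N => // n /= Nn; rewrite -ball_normE/= distrC.
  rewrite -(subnKC Nn) mulrnDr addrA (le_lt_trans (phin_le _ _ _)) ?psiA//.
  exact: lt_trans AN.
have f1_phi t : a < t -> `|f1 t - phi t| <= psi t.
  move=> at_; have : `|phi (t + T *+ n) - phi t| @[n --> \oo] --> `|f1 t - phi t|.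
    by apply: cvg_norm; apply: cvgB; [exact: f1_cvg|exact: cvg_cst].
  move=> /cvgr_to_le; apply; apply: nearW => n; exact: phin_le.
have f1T : periodic f1 T.
  move=> u; apply/esym/cvg_lim => //.
  have /= := f1_cvg (u + T).
  under eq_fun do rewrite -addrA -mulrS.
  by rewrite (cvg_shiftS (fun n => phi (u + T *+ n))).
(* Far enough to the right f1 is within e / 3 of phi, and the values of f1 near
   u are its values near u + NT. The margin 1 in A + 1 leaves room for the
   neighbours of u. *)
have cf1 : continuous f1.
  move=> u; apply/cvgrPdist_lt => e e0.
  have e30 : 0 < e / 3 by rewrite divr_gt0.
  have [A [aA A0 psiA]] := psi_small _ e30.
  have [N AN] := reach (A + 1) u.
  have uA : A < u + T *+ N by rewrite (lt_trans _ AN)// ltrDl.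
  have cN : phi (v + T *+ N) @[v --> u] --> phi (u + T *+ N).
    apply: (@continuous_comp _ _ _ (fun v => v + T *+ N) phi).
      by apply: cvgD; [exact: cvg_id|exact: cvg_cst].
    by apply: continuous_gt0 => //; exact: lt_trans uA.
  near=> v.
  have vA : A < v + T *+ N.
    have : u - 1 < v by near: v; apply: lt_nbhsr; rewrite ltrBlDr ltrDl.
    lra.
  have h1 := f1_phi _ (lt_trans aA uA); have h2 := f1_phi _ (lt_trans aA vA).
  have h3 := psiA _ uA; have h4 := psiA _ vA.
  have h5 : `|phi (u + T *+ N) - phi (v + T *+ N)| < e / 3.
    by near: v; move/cvgrPdist_lt: cN; apply.
  rewrite -(periodicn f1T N u) -(periodicn f1T N v).
  move: h1 h2 h3 h4 h5; rewrite !ler_norml !ltr_norml.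
  move=> /andP[? ?] /andP[? ?] ? ? /andP[? ?]; apply/andP; split; lra.
split => //; exists f1, (fun t => phi t - f1 t); split => //; last first.
  by move=> t _; rewrite addrC subrK.
have cf2 : {within `[0, +oo[, continuous (fun t => phi t - f1 t)}.
  move=> t; apply: cvgB; first exact: cphi.
  exact: (continuous_subspaceT cf1).
split => //.
- have [A [aA A0 psiA]] := psi_small _ (ltr01).
  have [M [_ HM]] : bounded_set ((fun t => phi t - f1 t) @` `[0, A]).
    apply: compact_bounded; apply: continuous_compact; last exact: segment_compact.
    by apply: continuous_subspaceW cf2; exact: subset_itvl.
  exists (Num.max M 1); split; first by rewrite num_real.
  move=> B; rewrite gt_max => /andP[MB B1] t /=; rewrite in_itv/= andbT => t0.
  have [tA|At] := leP t A.
    by apply: (HM B MB); exists t => //=; rewrite in_itv/= t0.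
  rewrite distrC (le_trans (f1_phi _ _)) ?(lt_trans aA)//.
  by rewrite ltW// (lt_trans (psiA _ At)).
- apply: (@squeeze_cvgr _ _ _ _ (cst 0) psi) => //; last exact: cvg_cst.
  near=> t; rewrite normr_ge0/= distrC f1_phi//.
  by near: t; apply: nbhs_pinfty_gt; exact: num_real.
Unshelve. all: by end_near. Qed.

(** * The Riemann-Liouville derivative *)

Lemma powRN_cvgy0 {R : realType} (p : R) :
  0 < p -> x `^ (- p) @[x --> +oo] --> (0 : R).
Proof.
move=> p0; apply/cvgrPdist_lt => e e0; near=> x.
have xe : e^-1 `^ p^-1 < x by near: x; apply: nbhs_pinfty_gt; exact: num_real.
have x0 : 0 < x by apply: le_lt_trans xe; exact: powR_ge0.
rewrite sub0r normrN ger0_norm ?powR_ge0// powRN invf_plt ?posrE ?powR_gt0//.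
have -> : e^-1 = (e^-1 `^ p^-1) `^ p.
  by rewrite -powRrM mulVf ?gt_eqF// powRr1// invr_ge0 ltW.
by apply: gt0_ltr_powR; rewrite // nnegrE ?powR_ge0// ltW.
Unshelve. all: by end_near. Qed.

Theorem theorem7 (R : realType) (T : R) (f : R -> R) (alpha : R) (phi : R -> R)
  (T_gt0 : 0 < T)
  (f_continuous : continuous f)
  (f_periodic : periodic f T)
  (alpha01 : 0 < alpha < 1)
  (I_bounded : [bounded fractional_integral (1 - alpha) f t | t in `]0, +oo[])
  (phi_RL : is_RL_derivative alpha f phi)
  (phi_continuous : {within `[0, +oo[, continuous phi}) :
  asymptotically_periodic T phi.
Proof.
have /andP[alpha_gt0 _] := alpha01.
have [K K_ge0 G_lipschitz] := fractional_integral_period_increment_lipschitz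
  f alpha T f_continuous f_periodic alpha01 T_gt0.
pose psi t := K * (t - T) `^ (- alpha).
have psiB t : psi t - psi (t + T) = K * ((t - T) `^ (- alpha) - t `^ (- alpha)).
  by rewrite /psi addrK mulrBr.
have psi_cvg : psi t @[t --> +oo] --> 0.
  rewrite -(mulr0 K); apply: cvgZr.
  apply: (cvg_comp (fun t => t - T) (fun x => x `^ (- alpha)) (cvg_addrr _)).
  exact: powRN_cvgy0.
apply: (@asymptotically_periodic_increment _ _ psi T T) => //; last first.
  by move=> t _; rewrite mulr_ge0 ?powR_ge0.
move=> t Tt; rewrite psiB -subr_le0.
pose g s := `|phi (s + T) - phi s| -
  K * ((s - T) `^ (- alpha) - s `^ (- alpha)).
apply: (@ae_continuous_le0 _ g T) => //.
  have phi_RL_T := ae_translate T _ phi_RL.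
  have aeF := ae_filter_ringOfSetsType (@lebesgue_measure R).
  apply: (@filterS2 _ _ aeF _ _ _ _ phi_RL phi_RL_T) => s ds dsT Ts.
  have s_gt0 : 0 < s by exact: lt_trans Ts.
  rewrite subr_le0; pose F := fractional_integral (1 - alpha) f.
  apply: (derive_le_lipschitz_right (fun u => F (u + T) - F u) s); last first.
    by move=> h h_gt0; exact: G_lipschitz.
  apply: (is_deriveB (f := fun u => F (u + T))); last exact: ds.
  have shift1 : is_derive s 1 (fun u : R => u + T) 1.
    by rewrite -[X in is_derive _ _ _ X]addr0; apply: is_deriveD.
  have := @realfun.is_derive1_comp R F (fun u => u + T) s _ _
    (dsT (addr_gt0 s_gt0 T_gt0)) shift1.
  by rewrite mulr1.
have t_gt0 : 0 < t by exact: lt_trans Tt.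
have cpowR (x : R) : 0 < x -> {for x, continuous (fun y => y `^ (- alpha))}.
  move=> x_gt0; apply: differentiable_continuous; apply/derivable1_diffP.
  by apply: derivable_powR; rewrite in_itv/= andbT.
apply: cvgB.
  apply: cvg_norm; apply: cvgB; last exact: continuous_gt0.
  apply: (@continuous_comp _ _ _ (fun v => v + T) phi).
    by apply: cvgD; [exact: cvg_id|exact: cvg_cst].
  by apply: continuous_gt0 => //; exact: addr_gt0.
apply: cvgZr; apply: cvgB; last exact: cpowR.
apply: (@continuous_comp _ _ _ (fun s => s - T) (fun x => x `^ (- alpha))).
  by apply: cvgB; [exact: cvg_id|exact: cvg_cst].
by apply: cpowR; rewrite subr_gt0.
Qed.
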